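(* Let $q\geq 1$ and $n\geq 3$ be integers and let $X$ be a connected $(q+1)$-regular undirected graph of finite order $n$ (loops and multiple edges allowed). For $k\geq 1$ let $N_k$ be the number of geodesic cycles on $X$ of length $k$. (i) If $X$ is nonbipartite, then $X$ is Ramanujan if and only if $$|N_k-q^k-1|\leq 2(n-1)q^{\frac k2}\quad\text{for all odd } k\geq 1$$ and $$|N_k-n(q-1)-q^k-1|\leq 2(n-1)q^{\frac k2}\quad\text{for all even } k\geq 2.$$ (ii) If $X$ is bipartite, then $X$ is Ramanujan if and only if $$|N_k-n(q-1)-2q^k-2|\leq 2(n-2)q^{\frac k2}\quad\text{for all even } k\geq 2.$$
   Context: Graphs: $X$ is an undirected graph of finite order (number of vertices) $n$, loops and multiple edges allowed. Each edge (including each loop) is given two opposite orientations, called oriented edges. The valency of a vertex $x$ is the number of oriented edges with initial vertex $x$; $X$ is $(q+1)$-regular if every vertex has valency $q+1$. The adjacency matrix $A$ has $(x,y)$-entry equal to the number of oriented edges from $x$ to $y$; its (real) eigenvalues are the eigenvalues of $X$. A walk is a nonempty finite sequence of oriented edges in which the terminal vertex of each is the initial vertex of the next; its length is the number of oriented edges. $X$ is connected if there is a walk between any two distinct vertices. A cycle is a walk from a vertex to itself; $X$ is bipartite if all cycles have even length. A walk has backtracking if some oriented edge is immediately followed by its opposite. A cycle is geodesic if all its cyclic shifts are backtrackless. Eigenvalues of $X$ with absolute value $q+1$ are trivial; the others are nontrivial. $X$ is Ramanujan if $|\lambda|\le 2q^{\frac12}$ for all nontrivial eigenvalues $\lambda$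 of $X$. *)

(* Defs.v *)
From HB Require Import structures.
From mathcomp Require Import all_boot all_order all_algebra.
From mathcomp Require Import reals exp.

Set Implicit Arguments.
Unset Strict Implicit.
Unset Printing Implicit Defensive.

Import Order.TTheory GRing.Theory Num.Theory.
Local Open Scope ring_scope.

(* A finite undirected graph, with loops and multiple edges allowed, given by
   its oriented edges. An undirected edge is a pair {e, opposite e}; as
   [opposite] has no fixed point, a loop also carries two distinct
   orientations, so it adds 2 to the valency of its vertex. *)
Record multigraph := Multigraph {
  vertex : finType;
  oedge : finType;
  src : oedge -> vertex;
  tgt : oedge -> vertex;
  opposite : oedge -> oedge;
  oppositeK : involutive opposite;
  opposite_neq : forall e, opposite e != e;
  src_opposite : forall e, src (opposite e) = tgt e
}.

Section Graph.
Variable X : multigraph.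
Implicit Types (x y : vertex X) (e f : oedge X) (w : seq (oedge X)).

Definition valency x : nat := #|[set e | src e == x]|.

Definition regular (d : nat) : Prop := forall x, valency x = d.

Definition walk_between x y w : bool :=
  if w is e :: w' then
    [&& src e == x, path (fun f g => tgt f == src g) e w'
      & tgt (last e w') == y]
  else false.

Definition connected_graph : Prop :=
  forall x y, x != y -> exists w, walk_between x y w.

Definition cycle_walk w : bool := [exists x, walk_between x x w].

Definition bipartite : Prop := forall w, cycle_walk w -> ~~ odd (size w).

Definition backtrackless w : bool := sorted (fun e f => f != opposite e) w.

Definition geodesic_cycle w : bool :=
  cycle_walk w && [forall i : 'I_(size w), backtrackless (rot i w)].

(* Cycles are sequences: they have a base point and a direction. *)
Definition num_geodesic_cycles (k : nat) : nat :=
  #|[set w : k.-tuple (oedge X) | geodesic_cycle w]|.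

End Graph.

Definition adjacency_matrix (R : realType) (X : multigraph) :
    'M[R]_#|vertex X| :=
  \matrix_(i, j)
    #|[set e : oedge X | (src e == enum_val i) && (tgt e == enum_val j)]|%:R.

Definition graph_eigenvalue (R : realType) (X : multigraph) (l : R) : bool :=
  eigenvalue (adjacency_matrix R X) l.

(* Ramanujan property of a (q+1)-regular graph. *)
Definition ramanujan (R : realType) (q : nat) (X : multigraph) : Prop :=
  forall l : R, graph_eigenvalue X l -> `|l| != q%:R + 1 ->
    `|l| <= 2 * q%:R `^ (1 / 2).

(* Main.v *)
(* Let W be the non-backtracking matrix on oriented edges, so that the number of
   geodesic cycles of length k is tr W^k. With S the matrix of sources, J that
   of edge reversal and T = S J that of targets, W = T^t S - J, S W = A S - T
   and T W = q S. Hence S W^k lies in the span of S and T with coefficients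
   polynomial in A, and unrolling one factor of W in tr W^k gives the trace form
   of the Ihara-Bass formula,
     tr W^k = sum_i (b_i^k + c_i^k) + n (q - 1) [k even],
   with b_i + c_i the i-th eigenvalue of A and b_i c_i = q.
   An eigenvalue l with |l| <= 2 sqrt q contributes at most 2 q^(k/2) in absolute
   value, so a Ramanujan graph satisfies the bounds. If |l| > 2 sqrt q then b, c
   are real and, along even k, the contribution outgrows every multiple of
   q^(k/2), while no other eigenvalue contributes less than - 2 q^(k/2).
   Finally q + 1 is a simple eigenvalue, and - (q + 1) is a simple eigenvalue if X
   is bipartite and not an eigenvalue otherwise. *)
Require Import Defs.
From mathcomp Require Import all_boot all_order all_algebra.
From mathcomp Require Import reals exp.
From mathcomp Require Import complex ring lra.

Import Order.TTheory GRing.Theory Num.Theory.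
Local Open Scope ring_scope.

(** * Real symmetric matrices *)

(** Over [R[i]] the matrix is Hermitian, so the spectral theorem gives real eigenvalues and a
    minimal polynomial with simple real roots. This factorization descends to [R]. *)
Lemma symmetric_diagonalizable (R : rcfType) (n : nat) (A : 'M[R]_n) :
  A^T = A -> exists2 P : 'M[R]_n, P \in unitmx &
             exists d : 'rV[R]_n, P *m A = diag_mx d *m P.
Proof.
case: n A => [|n] A symA.
  by exists 1%:M; [exact: unitmx1 | exists 0; rewrite [LHS]flatmx0 [RHS]flatmx0].
pose f := real_complex R.
pose B : 'M[R[i]]_n.+1 := map_mx f A.
have conjf x : (f x)^* = f x by apply/CrealP/complex_realP; exists x.
have hermB : B \is hermsymmx.
  apply/is_hermitianmxP; rewrite expr0 scale1r; apply/matrixP => i j.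
  by rewrite !mxE conjf -[in RHS]symA mxE.
have /orthomx_spectralP eqB := hermitian_normalmx hermB.
have /mxOverP realD := hermitian_spectral_diag_real hermB.
have Qunit := spectral_unit B.
move: (spectralmx B) (spectral_diag B) eqB realD Qunit => Q D eqB realD Qunit.
pose rs := undup [seq complex.Re (D 0 i) | i <- enum 'I_n.+1].
have minB :
    map_poly f (mxminpoly A) = map_poly f (\prod_(x <- rs) ('X - x%:P)).
  rewrite -mxminpoly_map -/B eqB -(conjVmx _ Qunit) mxminpoly_uconj ?unitmx_inv //.
  rewrite mxminpoly_diag map_prod_XsubC -[RHS](big_map f predT (fun x => 'X - x%:P)).
  rewrite /rs -(undup_map_inj (@complexI R)) -(map_comp f).
  congr (\prod_(x <- undup _) _); apply: eq_map => i; exact/esym/RRe_real/realD.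
have [P Punit /(diagonalizable_forLR Punit)[d eqA]] : diagonalizable A.
  apply/diagonalizableP; exists rs; first exact: undup_uniq.
  by rewrite (map_poly_inj _ minB).
by exists P => //; exists d; rewrite eqA mxpoly.conjVmx // !mulmxA mulmxV // mul1mx.
Qed.

(** * Dickson polynomials *)

(* Second kind. Not restricted to commutative rings, as it is evaluated at the
   adjacency matrix. *)
Fixpoint dickson2 (R : pzRingType) (q : nat) (a : R) (k : nat) : R :=
  match k with
  | 0 => 1
  | 1 => a
  | (k'.+1 as k1).+1 => dickson2 R q a k1 * a - dickson2 R q a k' *+ q
  end.
Arguments dickson2 {R} q a k.

(** First kind: the value at [b + c] with [b * c = q] is [b ^+ k + c ^+ k], hence 2 in degree 0. *)
Fixpoint dickson1 (R : comNzRingType) (q : nat) (a : R) (k : nat) : R :=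
  match k with
  | 0 => 2
  | 1 => a
  | (k'.+1 as k1).+1 => dickson1 R q a k1 * a - dickson1 R q a k' *+ q
  end.
Arguments dickson1 {R} q a k.

Lemma dickson1SS (R : comNzRingType) q (a : R) k :
  dickson1 q a k.+2 = dickson1 q a k.+1 * a - dickson1 q a k *+ q.
Proof. by []. Qed.

Lemma dickson2SS (R : pzRingType) q (a : R) k :
  dickson2 q a k.+2 = dickson2 q a k.+1 * a - dickson2 q a k *+ q.
Proof. by []. Qed.

Lemma dickson1_dickson2 (R : comNzRingType) q (a : R) k :
  dickson1 q a k.+2 = dickson2 q a k.+2 - dickson2 q a k *+ q.
Proof.
elim/ltn_ind: k => -[|[|k]] IH; [by rewrite /=; ring..|].
rewrite dickson1SS !IH // (dickson2SS _ _ _ k.+2) [in RHS](dickson2SS _ _ _ k).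
by rewrite !dickson2SS; ring.
Qed.

Lemma dickson1_sum (R : comNzRingType) q (a b : R) k : a * b = q%:R ->
  dickson1 q (a + b) k = a ^+ k + b ^+ k.
Proof.
move=> ab; elim/ltn_ind: k => -[|[|k]] IH; rewrite ?expr1 //.
rewrite dickson1SS !IH // -mulr_natr -ab !exprS; ring.
Qed.

(** Each step of the recursion multiplies the quadratic form [x^2 - a x y + q y^2] by [q]. *)
Lemma dickson2_norm (R : comNzRingType) q (a : R) k :
  dickson2 q a k.+1 ^+ 2 - a * dickson2 q a k.+1 * dickson2 q a k + dickson2 q a k ^+ 2 *+ q
  = q%:R ^+ k.+1.
Proof.
elim: k => [|k IH]; first by rewrite /=; ring.
by rewrite [in RHS]exprS -IH dickson2SS; ring.
Qed.

(** This is [(b^k + c^k)^2 = 4 (b c)^k + (b^k - c^k)^2] written without the roots [b] and [c], so it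
    also serves when they are not real. *)
Lemma dickson1_sqr (R : comNzRingType) q (a : R) k :
  dickson1 q a k.+1 ^+ 2 = 4 * q%:R ^+ k.+1 + (a ^+ 2 - 4 * q%:R) * dickson2 q a k ^+ 2.
Proof.
case: k => [|k]; first by rewrite /=; ring.
by rewrite dickson1_dickson2 dickson2SS [in RHS]exprS -(dickson2_norm R q a k); ring.
Qed.

Lemma dickson1_bound (R : realFieldType) q (a : R) k :
  a ^+ 2 <= 4 * q%:R -> dickson1 q a k ^+ 2 <= 4 * q%:R ^+ k.
Proof.
move=> ha; case: k => [|k]; first by rewrite /= expr0; lra.
rewrite dickson1_sqr gerDl mulr_le0_ge0 ?sqr_ge0 //; lra.
Qed.

Lemma bernoulli (R : realDomainType) (x : R) k : 1 <= x -> 1 + k%:R * (x - 1) <= x ^+ k.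
Proof.
move=> x_ge1; elim: k => [|k IH]; first by rewrite mul0r addr0.
have k_ge0 : 0 <= k%:R :> R := ler0n R k.
rewrite exprS -natr1; have : 0 <= k%:R * (x - 1) * (x - 1) by rewrite !mulr_ge0 ?subr_ge0.
by nra.
Qed.

Lemma expr_unbounded (R : realType) (x C : R) : 1 < x -> exists k, C < x ^+ k.+1.
Proof.
move=> x_gt1; pose k := Num.bound `|C / (x - 1)|; exists k.
have /ltW x_ge1 := x_gt1.
have x1_gt0 : 0 < x - 1 by rewrite subr_gt0.
apply: lt_le_trans (bernoulli R x k.+1 x_ge1).
have : C < k%:R * (x - 1).
  by rewrite -ltr_pdivrMr //; exact: le_lt_trans (ler_norm _) (archi_boundP (normr_ge0 _)).
by rewrite -natr1; nra.
Qed.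

Lemma dickson1_roots (R : rcfType) (q : nat) (a : R) :
  4 * q%:R <= a ^+ 2 -> exists b c, a = b + c /\ b * c = q%:R.
Proof.
move=> ha; pose s := Num.sqrt (a ^+ 2 - 4 * q%:R).
exists ((a + s) / 2), ((a - s) / 2); split; first by field.
have -> : (a + s) / 2 * ((a - s) / 2) = (a ^+ 2 - s ^+ 2) / 4 by field.
by rewrite sqr_sqrtr ?subr_ge0 //; field.
Qed.

(** Since [b^2 + c^2 = a^2 - 2 q > 2 q], the larger of the two squares exceeds [q]; in even degree
    the other root can only add to the sum. *)
Lemma dickson1_unbounded (R : realType) (q : nat) (a C : R) :
  (0 < q)%N -> 4 * q%:R < a ^+ 2 ->
  exists k, C * q%:R ^+ k.+1 < dickson1 q a k.+1.*2.
Proof.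
move=> q_gt0 ha; have q0 : 0 < q%:R :> R by rewrite ltr0n.
have [b [c [abc bc]]] := dickson1_roots _ _ _ (ltW ha).
have [k hk] : exists k, C * q%:R ^+ k.+1 < Num.max (b ^+ 2) (c ^+ 2) ^+ k.+1.
  have [|k hk] := @expr_unbounded R (Num.max (b ^+ 2) (c ^+ 2) / q%:R) C.
    rewrite ltr_pdivlMr // mul1r lt_max; apply/orP.
    have : 2 * q%:R < b ^+ 2 + c ^+ 2 by rewrite abc in ha; nra.
    by case: (ltP q%:R (b ^+ 2)) => ?; [left | right; lra].
  by exists k; rewrite -ltr_pdivlMr ?exprn_gt0 // -expr_div_n.
exists k; apply: lt_le_trans hk _.
rewrite abc (dickson1_sum _ _ _ _ _ bc) -mul2n !exprM.
by case: (leP (b ^+ 2) (c ^+ 2)) => _; rewrite ?lerDl ?lerDr exprn_ge0 ?sqr_ge0.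
Qed.

(** * Traces of powers of the non-backtracking matrix *)

Section Hashimoto.
(* [S] is to be read as the incidence matrix of sources and [J] as the
   permutation matrix of edge reversal, so that [S *m J] is the incidence matrix
   of targets. *)
Variables (R : comNzRingType) (n m q : nat) (S : 'M[R]_(n, m)) (J : 'M[R]_m).
Hypothesis SST : S *m S^T = q.+1%:R%:M.
Hypothesis JJ : J *m J = 1%:M.
Hypothesis trJ : \tr J = 0.
Hypothesis nm : m%:R = (n * q.+1)%:R :> R.
Let A := S *m J *m S^T.
Let W := J *m S^T *m S - J.
Let U := dickson2 q A.

Lemma src_hashimoto : S *m W = A *m S - S *m J.
Proof. by rewrite /W mulmxBr !mulmxA. Qed.

Lemma tgt_hashimoto : S *m J *m W = q%:R *: S.
Proof.
rewrite /W mulmxBr -(mulmxA S J J) JJ mulmx1 !mulmxA -(mulmxA S J J) JJ mulmx1.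
by rewrite SST mul_scalar_mx -natr1 scalerDl scale1r addrK.
Qed.

(** By the two relations above, right multiplication by [W] sends [x S - y S J] to
    [(x A - q y) S - x S J], which is the recursion of [dickson2]. *)
Lemma src_hashimotoX k : S *m W ^+ k.+1 = U k.+1 *m S - U k *m (S *m J).
Proof.
elim: k => [|k IH]; first by rewrite expr1 src_hashimoto [U 0]/= mul1mx.
rewrite exprSr [_ * W]/(_ *m W) mulmxA IH mulmxBl -!mulmxA src_hashimoto.
rewrite (mulmxA S) tgt_hashimoto mulmxBr /U [dickson2 q A k.+2]dickson2SS -/U.
rewrite -(scaler_nat q (U k)) mulmxBl -scalemxAl -scalemxAr -!mulmxA.
by rewrite addrAC.
Qed.

Local Notation a k := (\tr (W ^+ k)).
Local Notation b k := (\tr (J *m W ^+ k)).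
Local Notation t k := (\tr (U k)).

Lemma trace_UA k : \tr (U k.+1 *m A) = t k.+2 + q%:R * t k.
Proof.
rewrite /U [dickson2 q A k.+2]dickson2SS -/U -(scaler_nat q (U k)).
by rewrite linearB /= linearZ /= subrK.
Qed.

(** The remainder [J *m W ^+ k] makes the traces [a] and [b] recur into each other, so they are
    computed together. *)
Lemma hashimotoXS k : W ^+ k.+1 = J *m S^T *m S *m W ^+ k - J *m W ^+ k.
Proof. by rewrite exprS -mulmxBl. Qed.

Lemma trace_hashimotoS k : a k.+1 = \tr (S *m W ^+ k *m J *m S^T) - b k.
Proof.
rewrite hashimotoXS linearB /=; congr (_ - _).
by rewrite -!mulmxA mulmxA mxtrace_mulC !mulmxA.
Qed.

Lemma trace_opp_hashimotoS k : b k.+1 = \tr (S *m W ^+ k *m S^T) - a k.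
Proof.
rewrite hashimotoXS mulmxBr !mulmxA JJ !mul1mx linearB /=; congr (_ - _).
by rewrite -!mulmxA mxtrace_mulC !mulmxA.
Qed.

Lemma trace_hashimoto1 : a 1 = t 1.
Proof. by rewrite trace_hashimotoS expr0 !mulmx1 trJ subr0. Qed.

Lemma trace_opp_hashimoto1 : b 1 = 0.
Proof.
rewrite trace_opp_hashimotoS expr0 !mulmx1 SST mxtrace_scalar mxtrace1 nm.
by rewrite -mulrnA mulnC subrr.
Qed.

Lemma trace_hashimotoSS k : a k.+2 = t k.+2 - t k - b k.+1.
Proof.
rewrite trace_hashimotoS src_hashimotoX !mulmxBl -!mulmxA (mulmxA S) -/A.
rewrite (mulmxA J J) JJ mul1mx SST linearB /= trace_UA mul_mx_scalar linearZ /=.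
ring.
Qed.

Lemma trace_opp_hashimotoSS k : b k.+2 = q.+1%:R * t k.+1 - \tr (U k *m A) - a k.+1.
Proof.
rewrite trace_opp_hashimotoS src_hashimotoX !mulmxBl -!mulmxA SST (mulmxA S) -/A.
by rewrite linearB /= mul_mx_scalar linearZ.
Qed.

(** The recursions combine to [b (k+3) - b (k+1) = (q - 1) (t (k+2) - t k)], which telescopes. From
    [b 1 = 0], even [k] leave [t 0 = n] subtracted: this is the source of the term [n (q - 1)] in
    the trace formula. *)
Lemma trace_opp_hashimotoX k : b k.+1 = (q%:R - 1) * (t k - (~~ odd k * n)%:R).
Proof.
elim/ltn_ind: k => -[|[|k]] IH.
- by rewrite trace_opp_hashimoto1 /= mul1n mxtrace1 subrr mulr0.
- by rewrite trace_opp_hashimotoSS trace_hashimoto1 [U 0]/= mul1mx /=; ring.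
rewrite trace_opp_hashimotoSS trace_UA trace_hashimotoSS IH //= negbK; ring.
Qed.

Lemma trace_hashimotoX k :
  a k.+2 = t k.+2 - q%:R * t k + (~~ odd k * n)%:R * (q%:R - 1).
Proof. by rewrite trace_hashimotoSS trace_opp_hashimotoX; ring. Qed.

End Hashimoto.

Lemma trace_dickson2 (F : fieldType) n q (A P : 'M[F]_n) (d : 'rV[F]_n) k :
  P \in unitmx -> P *m A = diag_mx d *m P ->
  \tr (dickson2 q A k) = \sum_i dickson2 q (d 0 i) k.
Proof.
move=> Punit PA.
have PU : P *m dickson2 q A k = diag_mx (\row_i dickson2 q (d 0 i) k) *m P.
  elim/ltn_ind: k => -[|[|k]] IH.
  - rewrite [P *m _]mulmx1 -[LHS]mul1mx -diag_const_mx; congr (diag_mx _ *m _).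
    by apply/rowP => i; rewrite !mxE.
  - by rewrite [LHS]PA; congr (diag_mx _ *m _); apply/rowP => i; rewrite !mxE.
  rewrite dickson2SS mulmxBr -scaler_nat -scalemxAr IH // mulmxA IH //.
  rewrite -mulmxA PA scalemxAl mulmxA -mulmxBl mulmx_diag.
  congr (_ *m _); apply/matrixP => i j; rewrite !mxE.
  by case: (i == j); rewrite ?mulr1n ?mulr0n ?mulr0 ?subr0 // mulr_natl.
rewrite -[dickson2 q A k](mulKmx Punit) PU mxtrace_mulC mulmxK // mxtrace_diag.
by apply: eq_bigr => i _; rewrite mxE.
Qed.

(** * Counting geodesic cycles *)

Lemma sum_tuple_cons (V : nmodType) (E : finType) k (F : k.+1.-tuple E -> V) :
  \sum_w F w = \sum_x \sum_(w : k.-tuple E) F (cons_tuple x w).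
Proof.
rewrite pair_big /= (reindex (fun p : E * k.-tuple E => cons_tuple p.1 p.2)) //.
exists (fun w => (thead w, behead_tuple w)) => [[x w] _|w _] /=.
  by congr (_, _); apply/val_inj.
by apply/val_inj; case/tupleP: w => x w.
Qed.

Lemma sum_enum_val (V : nmodType) (T : finType) (F : T -> V) :
  \sum_(i < #|T|) F (enum_val i) = \sum_x F x.
Proof.
by rewrite [RHS](reindex (@enum_val T (mem T))) //=; exact: (onW_bij _ (enum_val_bij _)).
Qed.

Lemma relmxX (R : pzRingType) (E : finType) (r : rel E) k (i j : 'I_#|E|) :
  let M : 'M[R]_#|E| := \matrix_(i, j) (r (enum_val i) (enum_val j))%:R in
  (M ^+ k) i j = \sum_(w : k.-tuple E)
    (path r (enum_val i) w && (last (enum_val i) w == enum_val j))%:R.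
Proof.
move=> M; elim: k i => [|k IH] i.
  rewrite expr0 mxE (big_pred1 [tuple]) => [|w]; last exact/esym/eqP/tuple0.
  by rewrite /= (inj_eq enum_val_inj).
rewrite exprS sum_tuple_cons mxE.
rewrite -[RHS]sum_enum_val; apply: eq_bigr => l _; rewrite IH mulr_sumr; apply: eq_bigr => w _.
by rewrite mxE /= -natrM mulnb andbA.
Qed.

(** A cyclic sequence is a path issued from its own last entry, so each one is counted in exactly
    one diagonal entry. *)
Lemma trace_relmxX (R : pzRingType) (E : finType) (r : rel E) k :
  \tr ((\matrix_(i, j) (r (enum_val i) (enum_val j))%:R : 'M[R]_#|E|) ^+ k.+1)
  = #|[set w : k.+1.-tuple E | cycle r w]|%:R.
Proof.
rewrite /mxtrace (eq_bigr _ (fun i _ => relmxX _ _ _ _ _ _)) exchange_big /=.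
rewrite -sum1dep_card natr_sum [RHS]big_mkcond /=; apply: eq_bigr => w _.
rewrite (cycle_path (thead w)).
have lastE x : last x w = last (thead w) w by case/tupleP: w.
rewrite (bigD1 (enum_rank (last (thead w) w))) //= enum_rankK lastE eqxx andbT.
rewrite big1 ?addr0; first by case: path.
move=> i ne_i; rewrite lastE (_ : (_ == enum_val i) = false) ?andbF //.
by apply: contraNF ne_i => /eqP->; rewrite enum_valK.
Qed.

(** The shift by 0 sees every consecutive pair but the closing one, and one further shift brings
    that pair to the front. *)
Lemma geodesic_cycleE (X : multigraph) (w : seq (oedge X)) : w != [::] ->
  geodesic_cycle w = cycle [rel e f | (tgt e == src f) && (f != opposite e)] w.
Proof.
case: w => // e w _; rewrite /geodesic_cycle /cycle_walk.
have -> : [exists x, walk_between x x (e :: w)]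
          = cycle (fun e f : oedge X => tgt e == src f) (e :: w).
  rewrite /= rcons_path; apply/existsP/andP => [[x /and3P[/eqP-> -> /eqP->]]|[ew /eqP lst]].
    by [].
  by exists (src e); rewrite eqxx ew lst eqxx.
rewrite cycle_relI; congr (_ && _).
set nb := fun e f : oedge X => f != opposite e.
apply/forallP/idP => [geo|nbw i]; last first.
  have : cycle nb (rot i (e :: w)) by rewrite rot_cycle.
  by rewrite /backtrackless; case: rot => //= f v; rewrite rcons_path => /andP[].
(* For a single edge the closing pair is the edge with itself, which is never a backtracking since
   [opposite] has no fixed point. *)
case/lastP: w geo => [|w f] geo; first by rewrite /= /nb eq_sym opposite_neq.
have := geo ord0; rewrite [rot _ _]rot0 /= rcons_path => /andP[ew wf].
(* Rotating by [(size w).+1] gives [f :: e :: w]. *)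
have lt_w : ((size w).+1 < size (e :: rcons w f))%N by rewrite /= size_rcons.
have := geo (Ordinal lt_w); rewrite /= -cats1 -cat_cons (rot_size_cat (e :: w)) /=.
by case/andP=> fe _; rewrite cats1 !rcons_path last_rcons ew [nb f e]fe andbT.
Qed.

Definition hashimoto (R : pzRingType) (X : multigraph) : 'M[R]_#|oedge X| :=
  \matrix_(i, j) ((tgt (enum_val i) == src (enum_val j))
                  && (enum_val j != opposite (enum_val i)))%:R.

Lemma num_geodesic_cyclesE (R : pzRingType) (X : multigraph) k :
  (num_geodesic_cycles X k.+1)%:R = \tr (hashimoto R X ^+ k.+1).
Proof.
rewrite (trace_relmxX _ _ [rel e f | (tgt e == src f) && (f != opposite e)]).
congr _%:R; apply: eq_card => w; rewrite !inE geodesic_cycleE //.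
by case/tupleP: w.
Qed.

(** * Incidence and edge-reversal matrices of a multigraph *)

Section Incidence.
Variables (R : comNzRingType) (X : multigraph).

Definition src_mx : 'M[R]_(#|vertex X|, #|oedge X|) :=
  \matrix_(i, j) (src (enum_val j) == enum_val i)%:R.

Definition opposite_mx : 'M[R]_#|oedge X| :=
  \matrix_(i, j) (enum_val j == opposite (enum_val i))%:R.

Lemma opposite_mxl m (B : 'M[R]_(m, #|oedge X|)) i j :
  (B *m opposite_mx) i j = B i (enum_rank (opposite (enum_val j))).
Proof.
rewrite mxE (bigD1 (enum_rank (opposite (enum_val j)))) //=.
rewrite mxE enum_rankK oppositeK eqxx mulr1 big1 ?addr0 // => l ne_l.
rewrite mxE (_ : (_ == _) = false) ?mulr0 //.
by apply: contraNF ne_l => /eqP->; rewrite oppositeK enum_valK.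
Qed.

Lemma opposite_mxK : opposite_mx *m opposite_mx = 1%:M.
Proof.
apply/matrixP => i j; rewrite opposite_mxl !mxE enum_rankK.
by rewrite (inj_eq (can_inj (@oppositeK X))) (inj_eq enum_val_inj) eq_sym.
Qed.

Lemma opposite_mx_sym : opposite_mx^T = opposite_mx.
Proof.
by apply/matrixP => i j; rewrite !mxE eq_sym (can2_eq (@oppositeK X) (@oppositeK X)).
Qed.

Lemma trace_opposite_mx : \tr opposite_mx = 0.
Proof. by apply: big1 => i _; rewrite mxE eq_sym (negPf (opposite_neq _)). Qed.

Lemma src_mx_opposite i j :
  (src_mx *m opposite_mx) i j = (tgt (enum_val j) == enum_val i)%:R.
Proof. by rewrite opposite_mxl mxE enum_rankK src_opposite. Qed.

(** [opposite e] starts at [tgt e], so backtracking pairs are among the consecutive ones and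
    subtracting [opposite_mx] removes exactly these. *)
Lemma hashimotoE :
  hashimoto R X = opposite_mx *m src_mx^T *m src_mx - opposite_mx.
Proof.
apply/matrixP => i j; rewrite -opposite_mx_sym -trmx_mul opposite_mx_sym !mxE.
have -> : \sum_l (src_mx *m opposite_mx)^T i l * src_mx l j
          = (tgt (enum_val i) == src (enum_val j))%:R.
  rewrite (bigD1 (enum_rank (src (enum_val j)))) //= big1 ?addr0 => [|l ne_l].
    by rewrite [_^T _ _]mxE src_mx_opposite mxE enum_rankK eqxx mulr1.
  rewrite [src_mx l j]mxE (_ : (_ == _) = false) ?mulr0 //.
  by apply: contraNF ne_l => /eqP->; rewrite enum_valK.
case: eqP => [te|/eqP ne]; first by case: (enum_val j == _); rewrite /= ?subrr ?subr0.
rewrite (_ : (_ == opposite _) = false) ?subr0 //.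
by apply: contraNF ne => /eqP->; rewrite src_opposite.
Qed.

Lemma src_mx_regular d : regular X d -> src_mx *m src_mx^T = d%:R%:M.
Proof.
move=> reg; apply/matrixP => i j; rewrite !mxE.
under eq_bigr do rewrite !mxE -natrM mulnb.
rewrite (sum_enum_val _ _ (fun e => ((src e == enum_val i) && (src e == enum_val j))%:R)).
case: (eqVneq i j) => [<-|ne_ij].
  rewrite -(reg (enum_val i)) /valency -sum1dep_card natr_sum [RHS]big_mkcond /=.
  by apply: eq_bigr => e _; rewrite andbb; case: eqP.
rewrite big1 // => e _; case: eqP => // ->; rewrite (inj_eq enum_val_inj).
by rewrite (negPf ne_ij).
Qed.

Lemma card_oedge d : regular X d -> #|oedge X| = (#|vertex X| * d)%N.
Proof.
move=> reg; rewrite -sum1_card (partition_big (@src X) predT) //=.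
rewrite -sum_nat_const; apply: eq_bigr => x _.
by rewrite -(reg x) /valency -sum1dep_card.
Qed.
End Incidence.

Lemma adjacency_matrixE (R : realType) (X : multigraph) :
  adjacency_matrix R X = src_mx R X *m opposite_mx R X *m (src_mx R X)^T.
Proof.
apply/matrixP => i j; rewrite !mxE.
under eq_bigr do rewrite src_mx_opposite !mxE -natrM mulnb.
rewrite (sum_enum_val _ _ (fun e => ((tgt e == enum_val i) && (src e == enum_val j))%:R)).
(* The matrix product counts edges in the other direction; edge reversal matches the two counts. *)
rewrite -sum1dep_card natr_sum big_mkcond (reindex_inj (can_inj (@oppositeK X))) /=.
apply: eq_bigr => e _.
by rewrite src_opposite -(src_opposite (opposite e)) oppositeK; case: ifP.
Qed.

(** * Sums over the spectrum *)

Lemma le_2sqrt_exprn (R : realType) (q k : nat) (x : R) :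
  (`|x| <= 2 * q%:R `^ (k%:R / 2)) = (x ^+ 2 <= 4 * q%:R ^+ k).
Proof.
have -> : 4 * q%:R ^+ k = (2 * q%:R `^ (k%:R / 2)) ^+ 2 :> R.
  rewrite exprMn -(powR_mulrn 2 (powR_ge0 _ _)) -powRrM mulfVK ?pnatr_eq0 //.
  by rewrite powR_mulrn ?ler0n //; congr (_ * _); ring.
by rewrite -[x ^+ 2]real_normK ?num_real // ler_pXn2r // ?nnegrE ?mulr_ge0 ?powR_ge0.
Qed.

(** Either [dickson1_bound] applies, or the roots are real and their even powers nonnegative. It
    limits how far other eigenvalues can offset a large one. *)
Lemma dickson1_double_ge (R : rcfType) (q k : nat) (a : R) :
  - (2 * q%:R ^+ k) <= dickson1 q a k.*2.
Proof.
have [/(dickson1_bound R _ _ k.*2)|/ltW/dickson1_roots[b [c [-> bc]]]] :=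
  leP (a ^+ 2) (4 * q%:R).
  have -> : 4 * q%:R ^+ k.*2 = (2 * q%:R ^+ k) ^+ 2 :> R.
    by rewrite exprMn -exprM muln2; congr (_ * _); ring.
  rewrite -[dickson1 _ _ _ ^+ 2]real_normK ?num_real // ler_pXn2r // ?nnegrE //.
    by rewrite ler_norml => /andP[].
  by rewrite mulr_ge0 ?exprn_ge0.
rewrite (dickson1_sum _ _ _ _ _ bc) -mul2n !exprM.
have : 0 <= q%:R ^+ k :> R by rewrite exprn_ge0.
have : 0 <= (b ^+ 2) ^+ k by rewrite exprn_ge0 ?sqr_ge0.
have : 0 <= (c ^+ 2) ^+ k by rewrite exprn_ge0 ?sqr_ge0.
lra.
Qed.

Lemma sum_dickson1_bound (R : realType) (q k : nat) (I : finType) (T : pred I) (l : I -> R) :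
  (forall i, T i -> l i ^+ 2 <= 4 * q%:R) ->
  `|\sum_(i | T i) dickson1 q (l i) k| <= 2 * #|T|%:R * q%:R `^ (k%:R / 2).
Proof.
move=> hl; apply: le_trans (ler_norm_sum _ _ _) _.
have -> : 2 * #|T|%:R * q%:R `^ (k%:R / 2) = \sum_(i | T i) 2 * q%:R `^ (k%:R / 2) :> R.
  by rewrite sumr_const -mulr_natr; ring.
by apply: ler_sum => i Ti; rewrite le_2sqrt_exprn dickson1_bound ?hl.
Qed.

Lemma dickson1_bound_of_sums (R : realType) (q : nat) (I : finType) (T : pred I) (l : I -> R) :
  (0 < q)%N ->
  (forall k, (2 <= k)%N -> ~~ odd k ->
     `|\sum_(i | T i) dickson1 q (l i) k| <= 2 * #|T|%:R * q%:R `^ (k%:R / 2)) ->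
  forall i, T i -> l i ^+ 2 <= 4 * q%:R.
Proof.
move=> q_gt0 hsum i Ti; rewrite leNgt; apply/negP => hi.
(* Half of [4 * #|T|] absorbs the lower bound on the other terms, the other half beats the assumed
   upper bound. *)
have [k hk] := dickson1_unbounded R q (l i) (4 * #|T|%:R) q_gt0 hi.
have := hsum k.+1.*2; rewrite odd_double => /(_ isT isT).
have -> : k.+1.*2%:R / 2 = k.+1%:R :> R by rewrite -muln2 natrM mulfK ?pnatr_eq0.
rewrite powR_mulrn ?ler0n // => /(le_trans (ler_norm _)).
have ge_m j := dickson1_double_ge R q k.+1 (l j).
move: (k.+1.*2) hk ge_m => m hk ge_m; rewrite (bigD1 i Ti) /=.
(* Including the index [i] only weakens the lower bound and keeps the factor [#|T|]. *)
have : \sum_(j | T j) - (2 * q%:R ^+ k.+1) <= \sum_(j | T j && (j != i)) dickson1 q (l j) m.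
  rewrite [leLHS](bigD1 i) //= -[leRHS]add0r lerD //.
    by rewrite oppr_le0 mulr_ge0 ?exprn_ge0.
  exact: ler_sum.
rewrite sumr_const -[_ *+ #|_|]mulr_natr; move: hk; set Q := q%:R ^+ _; set N := #|T|%:R.
lra.
Qed.

(** The length is [k.+1], so [odd k] marks the even lengths. *)
Lemma ihara_trace (R : realType) (X : multigraph) (q : nat)
    (P : 'M[R]_#|vertex X|) (d : 'rV[R]_#|vertex X|) (k : nat) :
  regular X q.+1 -> P \in unitmx -> P *m adjacency_matrix R X = diag_mx d *m P ->
  (num_geodesic_cycles X k.+1)%:R
  = \sum_i dickson1 q (d 0 i) k.+1 + (odd k * #|vertex X|)%:R * (q%:R - 1) :> R.
Proof.
move=> reg Punit PA; rewrite num_geodesic_cyclesE hashimotoE.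
have SST := src_mx_regular R _ _ reg.
have JJ := opposite_mxK R X; have trJ := trace_opposite_mx R X.
have nm : #|oedge X|%:R = (#|vertex X| * q.+1)%:R :> R by rewrite (card_oedge _ _ reg).
rewrite adjacency_matrixE in PA; have trU := trace_dickson2 _ _ q _ _ _ _ Punit PA.
case: k => [|k].
  by rewrite (trace_hashimoto1 _ _ _ q _ _ trJ) trU mul0n mul0r addr0.
rewrite (trace_hashimotoX _ _ _ _ _ _ SST JJ trJ nm) !trU; congr (_ + _).
by rewrite mulr_sumr -sumrB; apply: eq_bigr => i _; rewrite dickson1_dickson2 mulr_natl.
Qed.

(** * Trivial eigenvalues *)

Section Walk.
Variable X : multigraph.

(** Unlike [walk_between], this admits the empty walk, which suits induction and concatenation. *)
Fixpoint walk (x y : vertex X) (w : seq (oedge X)) : bool :=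
  if w is e :: w' then (src e == x) && walk (tgt e) y w' else x == y.

Lemma walk_betweenE x y e w : walk_between x y (e :: w) = walk x y (e :: w).
Proof.
rewrite /=; congr (_ && _).
by elim: w e => [|f w IH] e //=; rewrite -IH eq_sym andbA.
Qed.

Lemma walk_cat x y z v w : walk x y v -> walk y z w -> walk x z (v ++ w).
Proof.
by elim: v x => [x /eqP->|e v IH x] //= /andP[-> /IH H] /H.
Qed.

Lemma walk_rev x y w : walk x y w -> walk y x (rev (map (@opposite X) w)).
Proof.
elim: w x => [x|e w IH x] /=; first by rewrite eq_sym.
case/andP=> /eqP<- /IH h; rewrite rev_cons -cats1; apply: walk_cat h _.
by rewrite /= src_opposite -[e in src e]oppositeK src_opposite !eqxx.
Qed.

Lemma connected_walk x y : connected_graph X -> exists w, walk x y w.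
Proof.
move=> con; case: (eqVneq x y) => [->|/con[[|e w] // hw]]; first by exists [::] => /=.
by exists (e :: w); rewrite -walk_betweenE.
Qed.

Lemma bipartiteP : bipartite X <-> forall x w, walk x x w -> ~~ odd (size w).
Proof.
split=> [bip x [//|e w] hw|hw w /existsP[x]].
  by apply: bip; apply/existsP; exists x; rewrite walk_betweenE.
by case: w => // e w; rewrite walk_betweenE => /hw.
Qed.

Variable R : realType.

Lemma twisted_walk (s : R) (v : vertex X -> R) x y w :
  (forall e, v (tgt e) = s * v (src e)) -> walk x y w -> v y = s ^+ size w * v x.
Proof.
move=> hv; elim: w x => [x /eqP->|e w IH x /= /andP[/eqP<- /IH->]]; first by rewrite mul1r.
by rewrite hv exprSr mulrA.
Qed.

(** The sign is the parity of a chosen walk from [x0]. Walking to [src e], across [e] and back from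
    [tgt e] is closed, hence even, so the parities at the two ends of [e] differ. *)
Lemma bipartite_sign : connected_graph X -> bipartite X -> (0 < #|vertex X|)%N ->
  exists2 v : vertex X -> R, (forall e, v (tgt e) = - v (src e)) & (forall x, v x != 0).
Proof.
move=> con /bipartiteP bip /card_gt0P[x0 _].
pose w x := xchoose (connected_walk x0 x con).
have wP x : walk x0 x (w x) := xchooseP _.
exists (fun x => (-1) ^+ size (w x)) => [e|x]; last by rewrite signr_eq0.
have : walk x0 x0 (w (src e) ++ e :: rev (map (@opposite X) (w (tgt e)))).
  by apply: walk_cat (wP _) _; rewrite /= eqxx walk_rev.
move=> /bip; rewrite size_cat /= size_rev size_map addnS /= oddD negbK => odd_w.
rewrite -signr_odd -[in RHS]signr_odd.
by case: (odd (size (w (src e)))) odd_w; case: odd => //; rewrite ?expr0 ?expr1 ?opprK.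
Qed.

End Walk.

Lemma mulmx_tr_eq0 (R : realDomainType) n (z : 'rV[R]_n) : z *m z^T = 0 -> z = 0.
Proof.
move=> /matrixP/(_ 0 0); rewrite !mxE => z0; apply/rowP => i; rewrite mxE.
have /allP/(_ i) : all (fun i => true ==> (z 0 i ^+ 2 == 0)) (index_enum 'I_n).
  rewrite -psumr_eq0 => [|j _]; last exact: sqr_ge0.
  by apply/eqP; rewrite -[RHS]z0; apply: eq_bigr => j _; rewrite mxE expr2.
by rewrite mem_index_enum sqrf_eq0 => /(_ isT)/eqP.
Qed.

Section Trivial.
Variables (R : realType) (X : multigraph) (q : nat).
Hypothesis reg : regular X q.+1.
Implicit Types (s : R) (v : 'rV[R]_#|vertex X|).
Let A := adjacency_matrix R X.
Let S := src_mx R X.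
Let J := opposite_mx R X.

Lemma mul_src_mx v j : (v *m S) 0 j = v 0 (enum_rank (src (enum_val j))).
Proof.
rewrite mxE (bigD1 (enum_rank (src (enum_val j)))) //= big1 => [|i ne_i].
  by rewrite mxE enum_rankK eqxx mulr1 addr0.
rewrite mxE (_ : (_ == _) = false) ?mulr0 //.
by apply: contraNF ne_i => /eqP->; rewrite enum_valK.
Qed.

Lemma mul_tgt_mx v j : (v *m S *m J) 0 j = v 0 (enum_rank (tgt (enum_val j))).
Proof. by rewrite opposite_mxl mul_src_mx enum_rankK src_opposite. Qed.

(** Turns the eigenvector equation for [q + 1] or [-(q + 1)] into an edgewise condition that
    propagates along walks. *)
Lemma trivial_eigenvectorP s v : s ^+ 2 = 1 ->
  v *m A = (s * q.+1%:R) *: v <->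
  forall e, v 0 (enum_rank (tgt e)) = s * v 0 (enum_rank (src e)).
Proof.
move=> ss; have SST : S *m S^T = q.+1%:R%:M := src_mx_regular R _ _ reg.
have JJ : J *m J = 1%:M := opposite_mxK R X.
have JT : J^T = J := opposite_mx_sym R X.
have AE : A = S *m J *m S^T := adjacency_matrixE R X.
have -> : (forall e, v 0 (enum_rank (tgt e)) = s * v 0 (enum_rank (src e)))
          <-> v *m S *m J = s *: (v *m S).
  split=> [h|/rowP h e].
    by apply/rowP => j; rewrite mul_tgt_mx mxE mul_src_mx.
  by have := h (enum_rank e); rewrite mul_tgt_mx mxE mul_src_mx enum_rankK.
split=> [vA|vSJ]; last first.
  by rewrite AE !mulmxA vSJ -scalemxAl -mulmxA SST mul_mx_scalar scalerA.
(* The squared norm of [v *m S *m J - s *: (v *m S)] expands to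
   [(q + 1) - 2 s^2 (q + 1) + s^2 (q + 1) = 0] times that of [v]. *)
apply/eqP; rewrite -subr_eq0; apply/eqP/mulmx_tr_eq0.
have vSJST : v *m S *m J *m S^T = (s * q.+1%:R) *: v by rewrite -vA AE !mulmxA.
have vSST : v *m S *m S^T = q.+1%:R *: v by rewrite -mulmxA SST mul_mx_scalar.
have -> : (v *m S *m J - s *: (v *m S))^T = J *m S^T *m v^T - s *: (S^T *m v^T).
  by rewrite linearB /= linearZ /= !trmx_mul JT mulmxA.
rewrite mulmxBl !mulmxBr -!scalemxAl -!scalemxAr.
rewrite !mulmxA -(mulmxA (v *m S) J J) JJ mulmx1 vSJST vSST -!scalemxAl.
by rewrite !scalerA !mulrA -expr2 ss mul1r !subrr.
Qed.

Lemma trivial_eigenvector_eq0 s v x : connected_graph X -> s ^+ 2 = 1 ->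
  v *m A = (s * q.+1%:R) *: v -> v 0 (enum_rank x) = 0 -> v = 0.
Proof.
move=> con ss /(trivial_eigenvectorP s v ss) hv vx0; apply/rowP => i; rewrite mxE.
have [w hw] := connected_walk X x (enum_val i) con.
have := twisted_walk X R s (fun y => v 0 (enum_rank y)) _ _ _ hv hw.
by rewrite enum_valK vx0 mulr0.
Qed.

Lemma twisted_closed_walk s v x w : connected_graph X -> s ^+ 2 = 1 ->
  v *m A = (s * q.+1%:R) *: v -> v != 0 -> walk X x x w -> s ^+ size w = 1.
Proof.
move=> con ss vA v0 hw; have hv := (trivial_eigenvectorP s v ss).1 vA.
have vx0 : v 0 (enum_rank x) != 0.
  by apply: contraNneq v0 => /(trivial_eigenvector_eq0 _ _ _ con ss vA)->.
have := twisted_walk X R s (fun y => v 0 (enum_rank y)) _ _ _ hv hw.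
by move/eqP; rewrite -{1}[v 0 _]mul1r (inj_eq (mulIf vx0)) => /eqP.
Qed.

Variables (P : 'M[R]_#|vertex X|) (d : 'rV[R]_#|vertex X|).
Hypothesis Punit : P \in unitmx.
Hypothesis PA : P *m A = diag_mx d *m P.

Lemma row_eigenvector i : row i P *m A = d 0 i *: row i P.
Proof. by rewrite -row_mul PA; apply/rowP => j; rewrite mul_diag_mx !mxE. Qed.

Lemma row_unitmx_neq0 i : row i P != 0.
Proof.
apply/eqP => Pi0; have /rowP/(_ i) : delta_mx 0 i = 0 :> 'rV[R]__.
  by apply: (can_inj (mulmxK Punit)); rewrite -rowE Pi0 mul0mx.
by move/eqP; rewrite !mxE !eqxx oner_eq0.
Qed.

Lemma eigenvalue_diag l : eigenvalue A l <-> exists i, d 0 i = l.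
Proof.
split=> [/eigenvalueP[v vA v0]|[i <-]]; last first.
  by apply/eigenvalueP; exists (row i P); [exact: row_eigenvector | exact: row_unitmx_neq0].
pose u := v *m invmx P.
have vE : v = u *m P by rewrite mulmxKV.
have u0 : u != 0 by apply: contraNneq v0 => u0; rewrite vE u0 mul0mx.
have uD : u *m diag_mx d = l *: u.
  apply: (can_inj (mulmxK Punit)).
  by rewrite -mulmxA -PA mulmxA -vE vA vE scalemxAl.
clearbody u; have [i ui] : exists i, u 0 i != 0.
  apply/existsP; apply: contraNT u0; rewrite negb_exists => /forallP h.
  by apply/eqP/rowP => i; rewrite [RHS]mxE; have := h i; rewrite negbK => /eqP.
exists i; have /rowP/(_ i) := uD; rewrite mul_mx_diag !mxE mulrC.
exact: (mulIf ui).
Qed.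

(** Some combination of the two eigenvectors vanishes at a vertex, hence everywhere by
    connectedness, against the independence of the rows of [P]. *)
Lemma trivial_eigenvalue_simple s i j : connected_graph X -> s ^+ 2 = 1 ->
  d 0 i = s * q.+1%:R -> d 0 j = s * q.+1%:R -> i = j.
Proof.
move=> con ss di dj; apply/eqP/negP => /negP ne_ij.
pose x := enum_val i; pose c l := row l P 0 (enum_rank x).
have c0 l : d 0 l = s * q.+1%:R -> c l != 0.
  move=> dl; apply: contraNneq (row_unitmx_neq0 l) => cl0.
  by rewrite (trivial_eigenvector_eq0 s (row l P) x con ss) // row_eigenvector dl.
pose v := c j *: row i P - c i *: row j P.
have v0 : v = 0.
  apply: (trivial_eigenvector_eq0 s v x con ss).
    rewrite mulmxBl -!scalemxAl !row_eigenvector di dj scalerBr !scalerA.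
    by rewrite !(mulrC (s * _)).
  by rewrite !mxE /c !mxE mulrC subrr.
have : (c j *: delta_mx 0 i - c i *: delta_mx 0 j) = 0 :> 'rV[R]__.
  by apply: (can_inj (mulmxK Punit)); rewrite mulmxBl -!scalemxAl -!rowE mul0mx.
move=> /rowP/(_ i)/eqP; rewrite !mxE !eqxx (negPf ne_ij) mulr1 mulr0 subr0.
by rewrite (negPf (c0 j dj)).
Qed.
End Trivial.

(** The two roots are [s * q] and [s]. *)
Lemma trivial_dickson1 (R : comNzRingType) (s : R) q k : s ^+ 2 = 1 ->
  dickson1 q (s * q.+1%:R) k = s ^+ k * (q%:R ^+ k + 1).
Proof.
move=> ss; have -> : s * q.+1%:R = s * q%:R + s by rewrite -natr1; ring.
by rewrite dickson1_sum ?exprMn ?mulrDr ?mulr1 // mulrAC -expr2 ss mul1r.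
Qed.

(** * Trivial and nontrivial parts of the spectrum *)

Section Spectrum.
Variables (R : realType) (X : multigraph) (q : nat).
Hypothesis reg : regular X q.+1.
Hypothesis con : connected_graph X.
Hypothesis X_gt0 : (0 < #|vertex X|)%N.
Variables (P : 'M[R]_#|vertex X|) (d : 'rV[R]_#|vertex X|).
Hypothesis Punit : P \in unitmx.
Hypothesis PA : P *m adjacency_matrix R X = diag_mx d *m P.

(** On indices rather than values, so that eigenvalues count with multiplicity. *)
Definition nontrivial : pred 'I_#|vertex X| := [pred i | `|d 0 i| != q%:R + 1].

Lemma ramanujanE : ramanujan R q X <-> forall i, nontrivial i -> d 0 i ^+ 2 <= 4 * q%:R.
Proof.
split=> [ram i nti|h l /(eigenvalue_diag _ _ _ _ Punit PA)[i <-] nti].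
  have /ram/(_ nti) : graph_eigenvalue X (d 0 i).
    by apply/(eigenvalue_diag _ _ _ _ Punit PA); exists i.
  by rewrite (le_2sqrt_exprn R q 1) expr1.
by rewrite (le_2sqrt_exprn R q 1) expr1 h.
Qed.

Lemma trivialP i :
  reflect (d 0 i = 1 * q.+1%:R \/ d 0 i = -1 * q.+1%:R) (~~ nontrivial i).
Proof.
rewrite /nontrivial /= negbK natr1 mul1r mulN1r eqr_norml ler0n andbT.
by apply: (iffP orP) => [[]/eqP ? | []?]; [left|right|left; apply/eqP|right; apply/eqP].
Qed.

Lemma trivial_eigenvalue_ex (s : R) (v : vertex X -> R) : s ^+ 2 = 1 ->
  (forall e, v (tgt e) = s * v (src e)) -> (forall x, v x != 0) ->
  exists i, d 0 i = s * q.+1%:R.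
Proof.
move=> ss hv v0; apply/(eigenvalue_diag _ _ _ _ Punit PA)/eigenvalueP.
exists (\row_i v (enum_val i)).
  by apply/(trivial_eigenvectorP R X q reg s _ ss) => e; rewrite !mxE !enum_rankK.
have /card_gt0P[x _] := X_gt0; apply/eqP => /rowP/(_ (enum_rank x))/eqP.
by rewrite !mxE enum_rankK (negPf (v0 x)).
Qed.

Lemma Perron_eigenvalue : exists i, d 0 i = 1 * q.+1%:R.
Proof.
apply: (trivial_eigenvalue_ex 1 (fun=> 1)) => [|e|x]; rewrite ?mulr1 ?expr1n //.
exact: oner_neq0.
Qed.

(** A sign flipped by every edge is an eigenvector for [-(q + 1)]; conversely, carrying such an
    eigenvector around a closed walk forces [(-1)^length = 1]. *)
Lemma bipartite_eigenvalue : bipartite X <-> exists i, d 0 i = -1 * q.+1%:R.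
Proof.
split=> [bip|[i di]].
  have [v hv v0] := bipartite_sign X R con bip X_gt0.
  apply: (trivial_eigenvalue_ex (-1) v _ _ v0) => [|e]; first by rewrite sqrrN expr1n.
  by rewrite mulN1r.
apply/bipartiteP => x w hw.
have ss : (-1) ^+ 2 = 1 :> R by rewrite sqrrN expr1n.
have ev : row i P *m adjacency_matrix R X = (-1 * q.+1%:R) *: row i P.
  by rewrite (row_eigenvector _ _ _ _ PA) di.
have := twisted_closed_walk R X q reg _ _ _ _ con ss ev (row_unitmx_neq0 _ _ _ Punit i) hw.
by rewrite -signr_odd; case: odd => //; rewrite expr1 => m1; exfalso; lra.
Qed.

Lemma trivial_simple i j s : s ^+ 2 = 1 -> d 0 i = s * q.+1%:R -> d 0 j = s * q.+1%:R -> i = j.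
Proof. exact: (trivial_eigenvalue_simple R X q reg P d Punit PA). Qed.

Lemma nontrivial_nonbipartite : ~ bipartite X ->
  exists2 i0, d 0 i0 = 1 * q.+1%:R & nontrivial =1 predC1 i0.
Proof.
move=> nbip; have [i0 d0] := Perron_eigenvalue; exists i0 => // i; apply/negb_inj.
rewrite /= negbK; apply/trivialP/eqP => [[di|di]|->]; last by left.
  by apply: trivial_simple di d0; rewrite expr1n.
by case: nbip; apply/bipartite_eigenvalue; exists i.
Qed.

Lemma nontrivial_bipartite : bipartite X ->
  exists i0 i1, [/\ d 0 i0 = 1 * q.+1%:R, d 0 i1 = -1 * q.+1%:R, i0 != i1
                 & nontrivial =1 predC (pred2 i0 i1)].
Proof.
move=> /bipartite_eigenvalue[i1 d1]; have [i0 d0] := Perron_eigenvalue.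
have q0 : 0 < q.+1%:R :> R by rewrite ltr0n.
exists i0, i1; split=> // [|i]; first by apply/eqP => eq_i; rewrite eq_i d1 in d0; lra.
apply/negb_inj; rewrite /= negbK.
apply/trivialP/orP => [[di|di]|[]/eqP->]; try by [left|right].
  by left; apply/eqP; apply: trivial_simple di d0; rewrite expr1n.
by right; apply/eqP; apply: trivial_simple di d1; rewrite sqrrN expr1n.
Qed.

End Spectrum.

Theorem theorem1p4 (R : realType) (q n : nat) (hq : (1 <= q)%N)
    (hn : (3 <= n)%N) (X : multigraph) (hX : #|vertex X| = n)
    (hconn : connected_graph X) (hreg : regular X q.+1) :
  (~ bipartite X ->
    (ramanujan R q X <->
      (forall k : nat, (1 <= k)%N -> odd k ->
         `|(num_geodesic_cycles X k)%:R - q%:R ^+ k - 1|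
           <= 2 * (n%:R - 1) * q%:R `^ (k%:R / 2) :> R) /\
      (forall k : nat, (2 <= k)%N -> ~~ odd k ->
         `|(num_geodesic_cycles X k)%:R - n%:R * (q%:R - 1) - q%:R ^+ k - 1|
           <= 2 * (n%:R - 1) * q%:R `^ (k%:R / 2) :> R))) /\
  (bipartite X ->
    (ramanujan R q X <->
      (forall k : nat, (2 <= k)%N -> ~~ odd k ->
         `|(num_geodesic_cycles X k)%:R - n%:R * (q%:R - 1) - 2 * q%:R ^+ k - 2|
           <= 2 * (n%:R - 2) * q%:R `^ (k%:R / 2) :> R))).
Proof.
have symA : (adjacency_matrix R X)^T = adjacency_matrix R X.
  by rewrite adjacency_matrixE !trmx_mul trmxK opposite_mx_sym mulmxA.
have [P Punit [d PA]] := symmetric_diagonalizable _ _ _ symA.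
have X_gt0 : (0 < #|vertex X|)%N by rewrite hX; apply: leq_trans hn.
have ihara_even k : (2 <= k)%N -> ~~ odd k -> (num_geodesic_cycles X k)%:R
    = \sum_i dickson1 q (d 0 i) k + n%:R * (q%:R - 1) :> R.
  case: k => // k _; rewrite /= negbK -hX => odd_k.
  by rewrite (ihara_trace R X q P d k hreg Punit PA) odd_k mul1n.
have ihara_odd k : (1 <= k)%N -> odd k -> (num_geodesic_cycles X k)%:R
    = \sum_i dickson1 q (d 0 i) k :> R.
  case: k => // k _ /= /negbTE even_k.
  by rewrite (ihara_trace R X q P d k hreg Punit PA) even_k mul0n mul0r addr0.
have cardI : #|'I_#|vertex X| | = n by rewrite card_ord.
rewrite (ramanujanE _ _ _ _ _ Punit PA).
set T := nontrivial R X q d.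
split=> [nbip|bip].
- have [i0 d0 ntE] := nontrivial_nonbipartite R X q hreg hconn X_gt0 P d Punit PA nbip.
  have cardT : #|T|%:R = n%:R - 1 :> R.
    rewrite -cardI [X in _ = X%:R - 1](cardD1 i0) inE natrD addrC addKr; congr _%:R.
    by apply: eq_card => i; rewrite [LHS]ntE !inE andbT.
  have sumE k : \sum_i dickson1 q (d 0 i) k
      = q%:R ^+ k + 1 + \sum_(i | T i) dickson1 q (d 0 i) k.
    rewrite (bigD1 i0 isT) d0 trivial_dickson1 ?expr1n // mul1r.
    by congr (_ + _); apply: eq_bigl => i; rewrite [RHS]ntE.
  rewrite -cardT; split=> [ram|[_ even_bound]].
    split=> k k_gt par_k; have := sum_dickson1_bound R q k _ T (d 0) ram.
      by rewrite ihara_odd // sumE; congr (`|_| <= _); ring.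
    by rewrite ihara_even // sumE; congr (`|_| <= _); ring.
  apply: dickson1_bound_of_sums => // k k_gt par_k.
  by have := even_bound k k_gt par_k; rewrite ihara_even // sumE; congr (`|_| <= _); ring.
have [i0 [i1 [d0 d1 i01 ntE]]] :=
  nontrivial_bipartite R X q hreg hconn X_gt0 P d Punit PA bip.
have cardT : #|T|%:R = n%:R - 2 :> R.
  rewrite -cardI -[X in _ = X%:R - 2](cardC (pred2 i0 i1)) card2 i01 natrD addrC addKr.
  congr _%:R.
  by apply: eq_card => i; rewrite [LHS]ntE.
(* In even degree [q + 1] and [-(q + 1)] contribute [q^k + 1] each. *)
have sumE k : ~~ odd k -> \sum_i dickson1 q (d 0 i) k
    = 2 * q%:R ^+ k + 2 + \sum_(i | T i) dickson1 q (d 0 i) k.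
  move=> /negbTE even_k; rewrite (bigD1 i0 isT) (bigD1 i1) 1?eq_sym // d0 d1.
  rewrite !trivial_dickson1 ?sqrrN ?expr1n // -(signr_odd _ k) even_k expr0 !mul1r /= addrA.
  congr (_ + _); first by ring.
  by apply: eq_bigl => i; rewrite [RHS]ntE /= negb_or.
rewrite -cardT; split=> [ram k k_gt par_k|even_bound].
  have := sum_dickson1_bound R q k _ T (d 0) ram.
  by rewrite ihara_even // sumE //; congr (`|_| <= _); ring.
apply: dickson1_bound_of_sums => // k k_gt par_k.
by have := even_bound k k_gt par_k; rewrite ihara_even // sumE //; congr (`|_| <= _); ring.
Qed.
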